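(* Let $L\ge 1$ be an integer, $0<b<1$, $0<\Delta<1$, let $b_1,\dots,b_L\in\mathbb{C}$ be distinct with $|b_\ell|=b$ for all $\ell$, and let $C_1,\dots,C_L\in\mathbb{C}\setminus\{0\}$. Let $(\alpha_n)_{n\ge 0}$ be a sequence of Verblunsky coefficients with $$\alpha_n=\sum_{\ell=1}^L C_\ell b_\ell^n+O((b\Delta)^n)\qquad (n\to\infty).$$ Then for every $\varepsilon>0$ there is an $N$ such that for all $n\ge N$ the orthonormal polynomial $\varphi_n$ has at most $L-1$ zeros, counted with multiplicity, in $\{z\in\mathbb{C} : |z|<b-\varepsilon\}$.
   Context: A sequence of Verblunsky coefficients is a sequence $(\alpha_n)_{n\ge0}$ in the open unit disk $\mathbb{D}$. The associated monic orthogonal polynomials on the unit circle are defined by $\Phi_0=1$ and $\Phi_{n+1}(z)=z\Phi_n(z)-\overline{\alpha_n}\,\Phi_n^*(z)$, where $\Phi_n^*(z)=z^n\,\overline{\Phi_n(1/\bar z)}$. The orthonormal polynomials are $\varphi_n=\Phi_n\big/\prod_{j=0}^{n-1}(1-|\alpha_j|^2)^{1/2}$. *)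

(* Defs.v *)
From HB Require Import structures.
From mathcomp Require Import all_boot all_order all_algebra.
From mathcomp Require Import all_classical all_reals all_analysis.
From mathcomp Require Import complex.

Set Implicit Arguments.
Unset Strict Implicit.
Unset Printing Implicit Defensive.

Import Order.TTheory GRing.Theory Num.Theory.
Import numFieldNormedType.Exports.

Local Open Scope ring_scope.

Definition is_verblunsky (C : numClosedFieldType) (alpha : nat -> C) : Prop :=
  forall n, `|alpha n| < 1.

(* The operation P |-> P^*, P^*(z) = z^n conj (P (1 / conj z)), on polynomials
   of degree at most n; it reverses and conjugates the coefficients (see
   [horner_star_poly]). *)
Definition star_poly (C : numClosedFieldType) (n : nat) (p : {poly C})
    : {poly C} :=
  \poly_(i < n.+1) (p`_(n - i))^*.

Fixpoint monic_opuc (C : numClosedFieldType) (alpha : nat -> C) (n : nat)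
    : {poly C} :=
  if n is m.+1 then
    'X * monic_opuc alpha m - (alpha m)^* *: star_poly m (monic_opuc alpha m)
  else 1.

Definition orthonormal_opuc (C : numClosedFieldType) (alpha : nat -> C)
    (n : nat) : {poly C} :=
  (\prod_(j < n) sqrtC (1 - `|alpha j| ^+ 2))^-1 *: monic_opuc alpha n.

(* The zeros of p listed with multiplicity (see [count_mem_zeros]); only
   meaningful for p != 0. *)
Definition zeros (C : numClosedFieldType) (p : {poly C}) : seq C :=
  sval (closed_field_poly_normal p).

Lemma horner_star_poly (C : numClosedFieldType) (n : nat) (p : {poly C})
    (z : C) :
  (size p <= n.+1)%N -> z != 0 ->
  (star_poly n p).[z] = z ^+ n * (p.[1 / z^*])^*.
Proof.
move=> sp z0; rewrite /star_poly horner_poly (horner_coef_wide _ sp).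
rewrite rmorph_sum mulr_sumr /= (reindex_inj rev_ord_inj) /=.
apply: eq_bigr => i _; have le_in : (i <= n)%N by rewrite -ltnS.
rewrite subSS subKn // mul1r rmorphM rmorphXn fmorphV /= conjCK mulrCA.
by rewrite exprVn -expfB_cond ?(negPf z0).
Qed.

Lemma size_monic_opuc (C : numClosedFieldType) (alpha : nat -> C) (n : nat) :
  size (monic_opuc alpha n) = n.+1.
Proof.
elim: n => [|n IHn] /=; first by rewrite size_poly1.
have p0 : monic_opuc alpha n != 0 by rewrite -size_poly_eq0 IHn.
rewrite mulrC size_polyDl size_mulX // IHn //.
rewrite ltnS size_polyN (leq_trans (size_scale_leq _ _)) //.
exact: size_poly.
Qed.

Lemma count_mem_zeros (C : numClosedFieldType) (p : {poly C}) (z : C) :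
  p != 0 -> count_mem z (zeros p) = mup z p.
Proof.
move=> p0; rewrite /zeros; case: closed_field_poly_normal => s /= Dp.
rewrite Dp -mul_polyC mupMr ?mu_prod_XsubC //.
by rewrite /root hornerC lead_coef_eq0.
Qed.

(* Main.v *)
(* If Phi_n had L zeros z_i with |z_i| <= r < b, it would annihilate the L x L
   matrix A with diagonal z_i and a small constant d above the diagonal, whose
   Euclidean operator norm is at most r + d < b.  The Szego recursion, applied
   to A, gives a lower bound for |u Phi_n^*(A)| and exponential convergence of
   Phi_j^*(A); summing the recursion, Phi_n(A) = 0 then says that
   sum_(j < n) conj(sum_l C_l b_l^j) A^(n-1-j) is O(q^n) for some q < b.
   Multiplying by prod_l (conj b_l - A) turns this into N_n(A) = O(q^n) for
   N_n(X) = sum_l conj(C_l b_l^n) prod_(k != l) (conj b_k - X), a polynomial of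
   degree < L.  Its value at conj b_1, which has modulus kappa b^n, is recovered
   from N_n(A) by Newton interpolation at the z_i, so b^n = O(q^n), which bounds
   n.  All constants are uniform in the z_i. *)
Require Import Defs.
From HB Require Import structures.
From mathcomp Require Import all_boot all_order all_algebra.
From mathcomp Require Import all_classical all_reals all_analysis.
From mathcomp Require Import complex.
From mathcomp Require Import ring lra.

Set Implicit Arguments.
Unset Strict Implicit.
Unset Printing Implicit Defensive.

Import Order.TTheory GRing.Theory Num.Theory.
Import numFieldNormedType.Exports.

Local Open Scope classical_set_scope.
Local Open Scope ring_scope.

(** * Reversed polynomials and the Szego recursion *)

Lemma star_polyMX (C : numClosedFieldType) (n : nat) (p : {poly C}) :
  (size p <= n.+1)%N -> star_poly n.+1 ('X * p) = star_poly n p.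
Proof.
move=> sp; apply/polyP => i; rewrite !coef_poly coefXM subn_eq0.
rewrite [(i < n.+1)%N]ltnS; case: (leqP i n) => [le_in|lt_ni].
  by rewrite ltnS (leqW le_in) subSn.
by rewrite rmorph0 if_same.
Qed.

(** Reversal at a fixed index is an involution; raising the index by one between the two reversals
    leaves a factor ['X]. *)
Lemma star_polyK (C : numClosedFieldType) (n : nat) (p : {poly C}) :
  (size p <= n.+1)%N -> star_poly n.+1 (star_poly n p) = 'X * p.
Proof.
move=> sp; apply/polyP => i; rewrite !coef_poly coefXM.
case: i => [|i] /=; first by rewrite subn0 ltnn rmorph0.
rewrite !ltnS subSS leq_subr; case: leqP => [le_in|lt_ni].
  by rewrite conjCK subKn.
by rewrite nth_default // (leq_trans sp).
Qed.

(** The second half of the Szego recursion: the conjugate-linear reversal of index [n.+1] is applied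
    to the defining one. *)
Lemma star_monic_opucS (C : numClosedFieldType) (alpha : nat -> C) (n : nat) :
  star_poly n.+1 (monic_opuc alpha n.+1) =
  star_poly n (monic_opuc alpha n) - alpha n *: ('X * monic_opuc alpha n).
Proof.
have sP : (size (monic_opuc alpha n) <= n.+1)%N by rewrite size_monic_opuc.
transitivity (star_poly n.+1 ('X * monic_opuc alpha n) -
    alpha n *: star_poly n.+1 (star_poly n (monic_opuc alpha n))); last first.
  by rewrite star_polyMX // star_polyK.
rewrite /=; move: (star_poly n _) => q; apply/polyP => i.
rewrite coefB coefZ !coef_poly; case: ifP => _; last by rewrite mulr0 subr0.
by rewrite coefB coefZ rmorphB rmorphM /= conjCK.
Qed.

(** The recursion unrolled: the term that enters at step j is multiplied by ['X] in each of the
    n-1-j later steps. *)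
Lemma monic_opuc_sum (C : numClosedFieldType) (alpha : nat -> C) (n : nat) :
  monic_opuc alpha n = 'X^n -
    \sum_(j < n) (alpha j)^* *:
      ('X^(n.-1 - j) * star_poly j (monic_opuc alpha j)).
Proof.
elim: n => [|n IHn]; first by rewrite big_ord0 subr0 expr0.
rewrite [LHS]/= [in 'X * _]IHn big_ord_recr /= subnn mul1r mulrBr -exprS.
rewrite opprD addrA; congr (_ - _ - _).
rewrite mulr_sumr; apply: eq_bigr => j _.
rewrite -scalerAr mulrA -exprS; congr (_ *: ('X^_ * _)).
by case: n {IHn} j => [[]|n j] //=; rewrite subSn // -ltnS.
Qed.

(** * The Euclidean norm of row vectors *)

Definition l2norm (C : numClosedFieldType) (n : nat) (u : 'rV[C]_n) : C :=
  sqrtC (dotmx u u).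

Lemma dotmxS (C : numClosedFieldType) (n : nat) (u v : 'rV[C]_n) :
  dotmx u v = \sum_j u 0 j * (v 0 j)^*.
Proof. by rewrite dotmxE mxE; apply: eq_bigr => j _; rewrite !mxE. Qed.

Lemma l2norm_ge0 (C : numClosedFieldType) (n : nat) (u : 'rV[C]_n) :
  0 <= l2norm u.
Proof. by rewrite sqrtC_ge0 dnorm_ge0. Qed.

Lemma sqr_l2norm (C : numClosedFieldType) (n : nat) (u : 'rV[C]_n) :
  l2norm u ^+ 2 = \sum_j `|u 0 j| ^+ 2.
Proof. by rewrite sqrtCK dotmxS; apply: eq_bigr => j _; rewrite normCK. Qed.

Lemma ler_l2norm (C : numClosedFieldType) (n : nat) (u v : 'rV[C]_n) :
  (l2norm u <= l2norm v) = (l2norm u ^+ 2 <= l2norm v ^+ 2).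
Proof. by rewrite ler_sqr // nnegrE l2norm_ge0. Qed.

Lemma l2normZ (C : numClosedFieldType) (n : nat) (a : C) (u : 'rV[C]_n) :
  l2norm (a *: u) = `|a| * l2norm u.
Proof.
apply/eqP; rewrite -(@eqrXn2 _ 2) ?mulr_ge0 ?l2norm_ge0 //; apply/eqP.
rewrite exprMn !sqr_l2norm mulr_sumr; apply: eq_bigr => j _.
by rewrite mxE normrM exprMn.
Qed.

Lemma l2normN (C : numClosedFieldType) (n : nat) (u : 'rV[C]_n) :
  l2norm (- u) = l2norm u.
Proof. by rewrite -scaleN1r l2normZ normrN1 mul1r. Qed.

Lemma l2norm0 (C : numClosedFieldType) (n : nat) :
  l2norm (0 : 'rV[C]_n) = 0.
Proof. by rewrite -(scale0r 0) l2normZ normr0 mul0r. Qed.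

Lemma l2norm_eq0 (C : numClosedFieldType) (n : nat) (u : 'rV[C]_n) :
  (l2norm u == 0) = (u == 0).
Proof. by rewrite sqrtC_eq0 dnorm_eq0. Qed.

Lemma ler_l2normD (C : numClosedFieldType) (n : nat) (u v : 'rV[C]_n) :
  l2norm (u + v) <= l2norm u + l2norm v.
Proof. by rewrite /l2norm; have [] := triangle_lerif (@dotmx C n) u v. Qed.

Lemma ler_l2normB (C : numClosedFieldType) (n : nat) (u v : 'rV[C]_n) :
  l2norm (u - v) <= l2norm u + l2norm v.
Proof. by rewrite -(l2normN v) ler_l2normD. Qed.

Lemma ler_l2norm_sum (C : numClosedFieldType) (n : nat) (I : Type)
    (r : seq I) (P : pred I) (F : I -> 'rV[C]_n) :
  l2norm (\sum_(i <- r | P i) F i) <= \sum_(i <- r | P i) l2norm (F i).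
Proof.
elim/big_rec2: _ => [|i x y _ le_xy]; first by rewrite l2norm0.
by rewrite (le_trans (ler_l2normD _ _)) // lerD2l.
Qed.

Lemma ler_entry_l2norm (C : numClosedFieldType) (n : nat) (u : 'rV[C]_n) j :
  `|u 0 j| <= l2norm u.
Proof.
rewrite -ler_sqr ?nnegrE ?l2norm_ge0 // sqr_l2norm (bigD1 j) //=.
by rewrite lerDl sumr_ge0 // => i _; rewrite exprn_ge0.
Qed.

Lemma l2norm_delta (C : numClosedFieldType) (n : nat) (j : 'I_n) :
  l2norm (delta_mx 0 j : 'rV[C]_n) = 1.
Proof.
apply/eqP; rewrite -(@eqrXn2 _ 2) ?l2norm_ge0 ?ler01 // expr1n sqr_l2norm.
rewrite (bigD1 j) //= big1 ?mxE ?eqxx ?normr1 ?expr1n ?addr0 // => i ij.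
by rewrite mxE eqxx (negPf ij) normr0 expr0n.
Qed.

(* |w - a u|^2 - |u - a^* w|^2 = (1 - |a|^2) (|w|^2 - |u|^2) *)
Lemma l2norm_moebius (C : numClosedFieldType) (n : nat) (a : C)
    (u w : 'rV[C]_n) :
  `|a| <= 1 -> l2norm u <= l2norm w ->
  l2norm (u - a^* *: w) <= l2norm (w - a *: u).
Proof.
move=> a1; rewrite !ler_l2norm !sqrtCK => le_uw.
rewrite -subr_ge0.
suff -> : dotmx (w - a *: u) (w - a *: u) -
    dotmx (u - a^* *: w) (u - a^* *: w) =
    (1 - `|a| ^+ 2) * (dotmx w w - dotmx u u).
  by rewrite mulr_ge0 // ?subr_ge0 // expr_le1.
rewrite !dotmxS -!sumrB mulr_sumr; apply: eq_bigr => j _.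
rewrite !mxE !rmorphB !rmorphM /= conjCK normCK.
set x := u 0 j; set y := w 0 j; set x' := x^*; set y' := y^*.
by ring.
Qed.

(** * The Szego recursion evaluated at a contraction *)

Lemma horner_mxX (C : numClosedFieldType) (m : nat) (A : 'M[C]_m.+1)
    (p : {poly C}) (v : 'rV[C]_m.+1) :
  v *m horner_mx A ('X * p) = v *m horner_mx A p *m A.
Proof. by rewrite mulrC rmorphM /= horner_mx_X mulmxA. Qed.

Lemma mul_monic_opucS (C : numClosedFieldType) (alpha : nat -> C) (m n : nat)
    (A : 'M[C]_m.+1) (v : 'rV[C]_m.+1) :
  v *m horner_mx A (monic_opuc alpha n.+1) =
  v *m horner_mx A (monic_opuc alpha n) *m A -
  (alpha n)^* *: (v *m horner_mx A (star_poly n (monic_opuc alpha n))).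
Proof.
by rewrite /= rmorphB /= horner_mxZ mulmxBr -scalemxAr horner_mxX.
Qed.

Lemma mul_star_opucS (C : numClosedFieldType) (alpha : nat -> C) (m n : nat)
    (A : 'M[C]_m.+1) (v : 'rV[C]_m.+1) :
  v *m horner_mx A (star_poly n.+1 (monic_opuc alpha n.+1)) =
  v *m horner_mx A (star_poly n (monic_opuc alpha n)) -
  alpha n *: (v *m horner_mx A (monic_opuc alpha n) *m A).
Proof.
by rewrite star_monic_opucS rmorphB /= horner_mxZ mulmxBr -scalemxAr horner_mxX.
Qed.

Lemma star_poly0_1 (C : numClosedFieldType) :
  star_poly 0 1 = 1 :> {poly C}.
Proof.
apply/polyP => -[|i]; rewrite coef_poly !coef1 //=.
exact: rmorph1.
Qed.

(* The matrix form of [|Phi_n| <= |Phi_n^*|] on the closed unit disk. *)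
Lemma ler_monic_star (C : numClosedFieldType) (alpha : nat -> C) (m n : nat)
    (A : 'M[C]_m.+1) (v : 'rV[C]_m.+1) :
  is_verblunsky alpha ->
  (forall u : 'rV_m.+1, l2norm (u *m A) <= l2norm u) ->
  l2norm (v *m horner_mx A (monic_opuc alpha n)) <=
  l2norm (v *m horner_mx A (star_poly n (monic_opuc alpha n))).
Proof.
move=> alpha1 A1; elim: n => [|n IHn].
  by rewrite star_poly0_1.
rewrite mul_monic_opucS mul_star_opucS.
by apply: l2norm_moebius; [exact/ltW/alpha1 | exact: le_trans (A1 _) _].
Qed.

(** Reverse triangle inequality for w - alpha_n u, where w = v Phi_n^*(A) dominates u = v Phi_n(A) A
    in norm. *)
Lemma ler_starS (C : numClosedFieldType) (alpha : nat -> C) (m n : nat)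
    (A : 'M[C]_m.+1) (v : 'rV[C]_m.+1) :
  is_verblunsky alpha ->
  (forall u : 'rV_m.+1, l2norm (u *m A) <= l2norm u) ->
  (1 - `|alpha n|) *
    l2norm (v *m horner_mx A (star_poly n (monic_opuc alpha n))) <=
  l2norm (v *m horner_mx A (star_poly n.+1 (monic_opuc alpha n.+1))).
Proof.
move=> alpha1 A1; rewrite mul_star_opucS.
set w := v *m horner_mx A (star_poly n _); set u := _ *m A.
have le_uw : l2norm u <= l2norm w.
  exact: le_trans (A1 _) (ler_monic_star _ _ alpha1 A1).
rewrite mulrBl mul1r lerBlDr.
have {1}-> : w = (w - alpha n *: u) + alpha n *: u by rewrite subrK.
by rewrite (le_trans (ler_l2normD _ _)) // lerD2l l2normZ ler_wpM2l.
Qed.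

(** Iterating the one-step bound from j to n costs the factors 1 - |alpha_i| with j <= i < n, whose
    product is at least c. *)
Lemma ler_star (C : numClosedFieldType) (alpha : nat -> C) (c : C)
    (m j n : nat) (A : 'M[C]_m.+1) (v : 'rV[C]_m.+1) :
  is_verblunsky alpha ->
  (forall k, c <= \prod_(i < k) (1 - `|alpha i|)) ->
  (forall u : 'rV_m.+1, l2norm (u *m A) <= l2norm u) ->
  (j <= n)%N ->
  c * l2norm (v *m horner_mx A (star_poly j (monic_opuc alpha j))) <=
  l2norm (v *m horner_mx A (star_poly n (monic_opuc alpha n))).
Proof.
move=> alpha1 cP A1; set G := fun k => l2norm (v *m horner_mx A
  (star_poly k (monic_opuc alpha k))); rewrite -/(G j) -/(G n) => le_jn.
have G0 k : 0 <= G k by exact: l2norm_ge0.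
pose p k := \prod_(i < k) (1 - `|alpha i|).
have a0 i : 0 <= 1 - `|alpha i| by rewrite subr_ge0 ltW.
have p01 k : 0 <= p k <= 1.
  rewrite prodr_ge0 /=; last by move=> i _; exact: a0.
  by apply: prodr_ile1 => i _; rewrite a0 lerBlDr lerDl /=.
(* The product over j <= i < n is p n / p j; cross-multiplying avoids the quotient. *)
suff le_G : p n * G j <= p j * G n.
  have [_ pj1] := andP (p01 j).
  apply: le_trans (ler_wpM2r (G0 j) (cP n)) _; apply: le_trans le_G _.
  by rewrite ler_piMl.
elim: n le_jn => [|n IHn]; first by rewrite leqn0 => /eqP->.
rewrite leq_eqVlt ltnS => /predU1P[-> //|/IHn{}IHn].
rewrite {1}/p big_ord_recr /= -/(p n) mulrAC.
apply: le_trans (ler_wpM2r (a0 n) IHn) _.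
by rewrite -mulrA ler_wpM2l ?(andP (p01 _)).1 // mulrC ler_starS.
Qed.

Lemma ler_geometric_tail (C : numClosedFieldType) (b : C) (j n : nat) :
  0 <= b < 1 -> (j <= n)%N -> \sum_(j <= i < n) b ^+ i <= b ^+ j / (1 - b).
Proof.
case/andP=> b0 b1 le_jn; rewrite ler_pdivlMr ?subr_gt0 // mulrC mulrBl mul1r.
rewrite mulr_sumr -sumrB.
rewrite (eq_bigr (fun i => - (b ^+ i.+1 - b ^+ i))); last first.
  by move=> i _; rewrite opprB exprS.
by rewrite sumrN telescope_sumr // opprB lerBlDr lerDl exprn_ge0.
Qed.

(** Each increment G (i+1) - G i is -alpha_i v Phi_i(A) A, of norm at most K b^i |G i|, and |G i| <=
    |G n| / c. Measuring the error against |G n| keeps the bound homogeneous in v. *)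
Lemma ler_star_tail (C : numClosedFieldType) (alpha : nat -> C) (c K b : C)
    (m j n : nat) (A : 'M[C]_m.+1) (v : 'rV[C]_m.+1)
    (G := fun k => v *m horner_mx A (star_poly k (monic_opuc alpha k))) :
  is_verblunsky alpha ->
  0 < c -> (forall k, c <= \prod_(i < k) (1 - `|alpha i|)) ->
  0 <= b < 1 -> (forall i, `|alpha i| <= K * b ^+ i) ->
  (forall u : 'rV_m.+1, l2norm (u *m A) <= l2norm u) ->
  (j <= n)%N ->
  l2norm (G n - G j) <= K * b ^+ j / (1 - b) / c * l2norm (G n).
Proof.
move=> alpha1 c0 cP b01 alphab A1 le_jn.
have K0 : 0 <= K by have := alphab 0%N; rewrite mulr1; apply: le_trans.
have -> : G n - G j = \sum_(j <= i < n) (G i.+1 - G i).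
  by rewrite telescope_sumr.
apply: le_trans (ler_l2norm_sum _ _ _) _.
apply: (@le_trans _ _ (\sum_(j <= i < n) K * b ^+ i * (l2norm (G n) / c))).
  rewrite !big_nat; apply: ler_sum => i /andP[_ lt_in].
  rewrite /G mul_star_opucS addrAC subrr add0r l2normN l2normZ.
  rewrite ler_pM ?l2norm_ge0 // ler_pdivlMr // mulrC.
  apply: le_trans (ler_star v alpha1 cP A1 (ltnW lt_in)).
  rewrite ler_wpM2l ?(ltW c0) //.
  exact: le_trans (A1 _) (ler_monic_star _ _ alpha1 A1).
rewrite -mulr_suml -mulr_sumr.
have -> : K * b ^+ j / (1 - b) / c * l2norm (G n) =
  K * (b ^+ j / (1 - b)) * (l2norm (G n) / c) by rewrite !mulrA mulrAC.
rewrite ler_wpM2r ?divr_ge0 ?l2norm_ge0 ?(ltW c0) //.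
by rewrite ler_wpM2l // ler_geometric_tail.
Qed.

(** * Consequences of Phi_n(A) = 0 *)

Lemma ler_l2norm_mulX (C : numClosedFieldType) (r : C) (m n : nat)
    (A : 'M[C]_m.+1) (u : 'rV[C]_m.+1) :
  0 <= r -> (forall u : 'rV_m.+1, l2norm (u *m A) <= r * l2norm u) ->
  l2norm (u *m horner_mx A 'X^n) <= r ^+ n * l2norm u.
Proof.
move=> r0 Ar; elim: n => [|n IHn].
  by rewrite expr0 rmorph1 mulmx1 mul1r.
rewrite exprS horner_mxX (le_trans (Ar _)) // [r ^+ n.+1]exprS -mulrA.
by rewrite ler_wpM2l.
Qed.

Lemma ler_geometric_convolution (C : numClosedFieldType) (r q : C) (n : nat) :
  0 <= r -> r < q -> \sum_(j < n) r ^+ (n.-1 - j) * q ^+ j <= q ^+ n / (q - r).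
Proof.
move=> r0 rq; rewrite ler_pdivlMr ?subr_gt0 // mulrC.
by rewrite -opprB mulNr -subrXX opprB lerBlDr lerDl exprn_ge0.
Qed.

(** The unrolled recursion and v Phi_n(A) = 0 express v A^n as the sum of conj(alpha_j) G_j
    A^(n-1-j). Replacing conj(alpha_j) by gamma_j and G_j by G_n makes an error of order q^j |G n|
    in the j-th coefficient vector, and v A^n itself is at most q^n |G n| / c. *)
Lemma ler_mul_convolution (C : numClosedFieldType) (alpha gamma : nat -> C)
    (c K b r q : C) (m n : nat) (A : 'M[C]_m.+1) (v : 'rV[C]_m.+1)
    (G := fun k => v *m horner_mx A (star_poly k (monic_opuc alpha k))) :
  is_verblunsky alpha ->
  0 < c -> (forall k, c <= \prod_(i < k) (1 - `|alpha i|)) ->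
  0 <= b < 1 -> 0 <= r < q -> q <= 1 -> b ^+ 2 <= q ->
  (forall i, `|alpha i| <= K * b ^+ i) ->
  (forall i, `|gamma i - (alpha i)^*| <= K * q ^+ i) ->
  (forall u : 'rV_m.+1, l2norm (u *m A) <= r * l2norm u) ->
  v *m horner_mx A (monic_opuc alpha n) = 0 ->
  l2norm (G n *m horner_mx A (\sum_(j < n) gamma j *: 'X^(n.-1 - j))) <=
  ((K + K * K / (1 - b) / c) / (q - r) + c^-1) * q ^+ n * l2norm (G n).
Proof.
move=> alpha1 c0 cP b01 /andP[r0 rq] q1 b2q alphab gammaq Ar vPhi.
have [b0 b1] := andP b01.
have K0 : 0 <= K by have := alphab 0%N; rewrite mulr1; apply: le_trans.
have q0 : 0 <= q by rewrite (le_trans r0) ?ltW.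
have A1 (u : 'rV_m.+1) : l2norm (u *m A) <= l2norm u.
  by rewrite (le_trans (Ar u)) // ler_piMl ?l2norm_ge0 // (le_trans _ q1) ?ltW.
have vXn : v *m horner_mx A 'X^n =
    \sum_(j < n) (alpha j)^* *: (G j *m horner_mx A 'X^(n.-1 - j)).
  move: vPhi; rewrite monic_opuc_sum rmorphB /= mulmxBr => /subr0_eq ->.
  rewrite rmorph_sum mulmx_sumr; apply: eq_bigr => j _ /=.
  rewrite horner_mxZ -scalemxAr; congr (_ *: _).
  by rewrite mulrC rmorphM /= mulmxA.
(* With a = conj(alpha_j): gamma_j G_n = (gamma_j - a) G_n + a (G_n - G_j) + a G_j, and the last
   terms add up to v A^n. *)
have -> : G n *m horner_mx A (\sum_(j < n) gamma j *: 'X^(n.-1 - j)) =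
    \sum_(j < n) ((gamma j - (alpha j)^*) *: G n + (alpha j)^* *: (G n - G j))
       *m horner_mx A 'X^(n.-1 - j) + v *m horner_mx A 'X^n.
  rewrite vXn rmorph_sum mulmx_sumr -big_split /=; apply: eq_bigr => j _.
  rewrite horner_mxZ -scalemxAr scalerBl scalerBr addrA subrK mulmxBl.
  by rewrite -!scalemxAl subrK.
apply: le_trans (ler_l2normD _ _) _; rewrite mulrDl mulrDl lerD //; last first.
  apply: le_trans (ler_l2norm_mulX _ _ r0 Ar) _.
  rewrite [_^-1 * _]mulrC -mulrA ler_pM ?exprn_ge0 ?l2norm_ge0 //.
    by rewrite lerXn2r // ?nnegrE // ltW.
  rewrite mulrC ler_pdivlMr // mulrC.
  have := ler_star v alpha1 cP A1 (leq0n n).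
  by rewrite star_poly0_1 rmorph1 mulmx1.
apply: le_trans (ler_l2norm_sum _ _ _) _.
apply: (@le_trans _ _ (\sum_(j < n) r ^+ (n.-1 - j) * q ^+ j *
    ((K + K * K / (1 - b) / c) * l2norm (G n)))).
  apply: ler_sum => j _; apply: le_trans (ler_l2norm_mulX _ _ r0 Ar) _.
  rewrite -mulrA ler_wpM2l ?exprn_ge0 //.
  apply: le_trans (ler_l2normD _ _) _; rewrite !l2normZ mulrDl mulrDr lerD //.
    by rewrite mulrA [q ^+ j * K]mulrC ler_wpM2r ?l2norm_ge0.
  have le_jn : (j <= n)%N by rewrite ltnW.
  have tail := ler_star_tail v alpha1 c0 cP b01 alphab A1 le_jn.
  rewrite norm_conjC.
  apply: le_trans (ler_pM (normr_ge0 _) (l2norm_ge0 _) (alphab j) tail) _.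
  rewrite !mulrA ler_wpM2r ?l2norm_ge0 //.
  rewrite !ler_pM2r ?invr_gt0 ?subr_gt0 //.
  (* One b^j comes from alpha_j and one from the tail G_n - G_j; b^2 <= q absorbs both. *)
  have -> : K * b ^+ j * K * b ^+ j = (b ^+ 2) ^+ j * K * K.
    by rewrite -exprM mulnC exprM; ring.
  by rewrite !ler_wpM2r // lerXn2r // nnegrE exprn_ge0.
rewrite -mulr_suml; set B := K + _.
have -> : B / (q - r) * q ^+ n * l2norm (G n) =
  q ^+ n / (q - r) * (B * l2norm (G n)).
  by move: (q - r)^-1 => d; ring.
rewrite ler_wpM2r //.
  rewrite mulr_ge0 ?l2norm_ge0 // addr_ge0 // !mulr_ge0 ?invr_ge0 ?subr_ge0 //.
    exact: ltW.
  exact: ltW.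
exact: ler_geometric_convolution.
Qed.

(** The lower bound c |v| <= |v Phi_n^*(A)| makes Phi_n^*(A) invertible, so every u has the form v
    Phi_n^*(A) and the factor G n can be replaced by u. *)
Lemma ler_unit_mul_convolution (C : numClosedFieldType)
    (alpha gamma : nat -> C)
    (c K b r q : C) (m n : nat) (A : 'M[C]_m.+1) (u : 'rV[C]_m.+1) :
  is_verblunsky alpha ->
  0 < c -> (forall k, c <= \prod_(i < k) (1 - `|alpha i|)) ->
  0 <= b < 1 -> 0 <= r < q -> q <= 1 -> b ^+ 2 <= q ->
  (forall i, `|alpha i| <= K * b ^+ i) ->
  (forall i, `|gamma i - (alpha i)^*| <= K * q ^+ i) ->
  (forall u : 'rV_m.+1, l2norm (u *m A) <= r * l2norm u) ->
  horner_mx A (monic_opuc alpha n) = 0 ->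
  l2norm (u *m horner_mx A (\sum_(j < n) gamma j *: 'X^(n.-1 - j))) <=
  ((K + K * K / (1 - b) / c) / (q - r) + c^-1) * q ^+ n * l2norm u.
Proof.
move=> alpha1 c0 cP b01 r0q q1 b2q alphab gammaq Ar Phi0.
have A1 (w : 'rV_m.+1) : l2norm (w *m A) <= l2norm w.
  rewrite (le_trans (Ar w)) // ler_piMl ?l2norm_ge0 // (le_trans _ q1) ?ltW //.
  by case/andP: r0q.
pose M := horner_mx A (star_poly n (monic_opuc alpha n)).
have uM : M \in unitmx.
  rewrite -row_free_unit -kermx_eq0; apply/rowV0P => v /sub_kermxP vM0.
  have := ler_star v alpha1 cP A1 (leq0n n).
  rewrite star_poly0_1 rmorph1 mulmx1 -/M vM0 l2norm0 pmulr_rle0 // => v0.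
  by apply/eqP; rewrite -l2norm_eq0 eq_le v0 l2norm_ge0.
have := ler_mul_convolution alpha1 c0 cP b01 r0q q1 b2q alphab gammaq Ar
  (v := u *m invmx M) (n := n).
by rewrite Phi0 mulmx0 mulmxKV //; apply.
Qed.

(** * Bidiagonal matrices and Newton interpolation *)

(** For d != 0 the superdiagonal makes the first basis vector cyclic even when some [z i] coincide,
    so multiple zeros need no separate treatment; a small d keeps the norm close to the largest |z
    i|. *)
Definition bidiag_mx (C : numClosedFieldType) (m : nat) (z : 'I_m.+1 -> C)
    (d : C) : 'M[C]_m.+1 :=
  diag_mx (\row_i z i) + d *: \matrix_(i, j) (j == i.+1 :> nat)%:R.

Lemma char_poly_bidiag (C : numClosedFieldType) (m : nat) (z : 'I_m.+1 -> C)
    (d : C) :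
  char_poly (bidiag_mx z d) = \prod_i ('X - (z i)%:P).
Proof.
(* The transpose is lower triangular, the form that [char_poly_trig] expects. *)
have -> : char_poly (bidiag_mx z d) = char_poly (bidiag_mx z d)^T.
  rewrite /char_poly -det_tr; congr (\det _); apply/matrixP => i j.
  by rewrite !mxE eq_sym.
rewrite char_poly_trig; last first.
  apply/is_trig_mxP => i j lt_ij; rewrite !mxE.
  by rewrite (ltn_eqF (leqW lt_ij)) mulr0 addr0 -val_eqE gtn_eqF.
apply: eq_bigr => i _; rewrite !mxE eqxx mulr1n.
by rewrite (ltn_eqF (ltnSn i)) mulr0 addr0.
Qed.

Lemma l2norm_mul_diag (C : numClosedFieldType) (m : nat) (z : 'I_m.+1 -> C)
    (r : C) (u : 'rV[C]_m.+1) :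
  0 <= r -> (forall i, `|z i| <= r) ->
  l2norm (u *m diag_mx (\row_i z i)) <= r * l2norm u.
Proof.
move=> r0 zr; rewrite -ler_sqr ?nnegrE ?mulr_ge0 ?l2norm_ge0 //.
rewrite exprMn !sqr_l2norm mulr_sumr; apply: ler_sum => j _.
rewrite mul_mx_diag !mxE normrM exprMn mulrC ler_wpM2r ?exprn_ge0 //.
by rewrite ler_sqr ?nnegrE.
Qed.

Lemma l2norm_mul_shift (C : numClosedFieldType) (m : nat)
    (u : 'rV[C]_m.+1) :
  l2norm (u *m \matrix_(i, j < m.+1) (j == i.+1 :> nat)%:R) <= l2norm u.
Proof.
rewrite ler_l2norm !sqr_l2norm big_ord_recl big_ord_recr /= !mxE.
rewrite big1 => [|i _]; last by rewrite mxE mulr0.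
rewrite normr0 expr0n add0r -[X in X <= _]addr0 lerD ?exprn_ge0 //.
apply: ler_sum => j _; rewrite !mxE (bigD1 (widen_ord (leqnSn m) j)) //=.
rewrite big1 ?addr0 => [|i neq_ij]; first by rewrite mxE eqxx mulr1.
rewrite mxE /= /bump leq0n add1n eqSS [_ == _](_ : _ = false) ?mulr0 //.
by apply: contraNF neq_ij => /eqP ji; apply/eqP/val_inj.
Qed.

Lemma l2norm_mul_bidiag (C : numClosedFieldType) (m : nat)
    (z : 'I_m.+1 -> C) (r d : C) (u : 'rV[C]_m.+1) :
  0 <= r -> 0 <= d -> (forall i, `|z i| <= r) ->
  l2norm (u *m bidiag_mx z d) <= (r + d) * l2norm u.
Proof.
move=> r0 d0 zr; rewrite mulmxDr -scalemxAr (le_trans (ler_l2normD _ _)) //.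
rewrite mulrDl lerD ?l2norm_mul_diag // l2normZ (ger0_norm d0).
by rewrite ler_wpM2l // l2norm_mul_shift.
Qed.

(* The pairing of [e_0 p(A)] with this column is [p(x)] for [deg p <= m]: its
   entries are the values at [x] of the rescaled Newton basis at [z]. *)
Definition newton_col (C : numClosedFieldType) (m : nat) (z : 'I_m.+1 -> C)
    (d x : C) : 'cV[C]_m.+1 :=
  \col_i \prod_(k < m.+1 | (k < i)%N) ((x - z k) / d).

Lemma mul_bidiagE (C : numClosedFieldType) (m : nat) (z : 'I_m.+1 -> C)
    (d : C) (w : 'rV[C]_m.+1) (j : 'I_m.+1) :
  (w *m bidiag_mx z d) 0 j =
  w 0 j * z j + d * \sum_(i < m.+1 | j == i.+1 :> nat) w 0 i.
Proof.
rewrite mulmxDr -scalemxAr mul_mx_diag !mxE; congr (_ + d * _).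
rewrite [RHS]big_mkcond; apply: eq_bigr => i _; rewrite mxE.
by case: ifP => _; rewrite ?mulr1 ?mulr0.
Qed.

(** The Newton column g satisfies z_i g_i + d g_(i+1) = x g_i, so it is an eigenvector for x except
    in the last row, which a w with last entry 0 does not see. *)
Lemma mul_bidiag_newton (C : numClosedFieldType) (m : nat)
    (z : 'I_m.+1 -> C) (d x : C) (w : 'rV[C]_m.+1) :
  d != 0 -> w 0 ord_max = 0 ->
  w *m bidiag_mx z d *m newton_col z d x = x *: (w *m newton_col z d x).
Proof.
move=> d0 w0; rewrite -mulmxA scalemxAr.
apply/matrixP => i0 j0; rewrite !ord1 {i0 j0} !mxE.
apply: eq_bigr => i _.
have [->|neq_i] := eqVneq i ord_max; first by rewrite w0 !mul0r.
have lt_im : (i < m)%N.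
  by rewrite ltn_neqAle -ltnS ltn_ord andbT.
congr (_ * _); rewrite mulmxDl mul_diag_mx -scalemxAl !mxE.
set g := \prod_(k < m.+1 | (k < i)%N) _.
pose i1 : 'I_m.+1 := Ordinal (lt_im : i.+1 < m.+1)%N.
rewrite (bigD1 i1) //= big1 => [|k neq_k]; last first.
  rewrite !mxE [_ == _](_ : _ = false) ?mul0r //.
  by apply: contraNF neq_k => /eqP ki; apply/eqP/val_inj.
rewrite !mxE eqxx mul1r addr0 (bigD1 i) //=.
rewrite (eq_bigl (fun k : 'I_m.+1 => (k < i)%N)); last first.
  by move=> k; rewrite ltnS ltn_neqAle andbC.
by rewrite -/g; field.
Qed.

(** Each multiplication by the matrix spreads the support by one place to the right; for k < m the
    last entry is thus still 0. *)
Lemma mul_bidiagX_eq0 (C : numClosedFieldType) (m : nat)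
    (z : 'I_m.+1 -> C) (d : C) (k : nat) (j : 'I_m.+1) :
  (k < j)%N ->
  ((delta_mx 0 ord0 : 'rV_m.+1) *m horner_mx (bidiag_mx z d) 'X^k) 0 j = 0.
Proof.
elim: k j => [|k IHk] j lt_kj.
  by rewrite expr0 rmorph1 mulmx1 mxE eqxx; case: eqP lt_kj => [->|].
rewrite exprS horner_mxX mul_bidiagE.
have -> := IHk j (ltnW lt_kj); rewrite mul0r add0r.
rewrite big1 ?mulr0 // => i /eqP ji; apply: IHk.
by rewrite ji in lt_kj.
Qed.

Lemma mul_bidiagX_newton (C : numClosedFieldType) (m : nat)
    (z : 'I_m.+1 -> C) (d x : C) (k : nat) :
  d != 0 -> (k <= m)%N ->
  (delta_mx 0 ord0 : 'rV_m.+1) *m horner_mx (bidiag_mx z d) 'X^k *m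
    newton_col z d x = (x ^+ k)%:M.
Proof.
move=> d0; elim: k => [_|k IHk lt_km].
  rewrite expr0 rmorph1 mulmx1 -rowE; apply/matrixP => i j.
  by rewrite !ord1 !mxE eqxx big_pred0.
rewrite exprS horner_mxX mul_bidiag_newton //; last exact: mul_bidiagX_eq0.
by rewrite IHk ?(ltnW lt_km) // scale_scalar_mx exprS.
Qed.

Lemma mul_bidiag_poly_newton (C : numClosedFieldType) (m : nat)
    (z : 'I_m.+1 -> C) (d x : C) (p : {poly C}) :
  d != 0 -> (size p <= m.+1)%N ->
  (delta_mx 0 ord0 : 'rV_m.+1) *m horner_mx (bidiag_mx z d) p *m
    newton_col z d x = (p.[x])%:M.
Proof.
move=> d0 sp; rewrite -{1}(coefK p) poly_def horner_coef raddf_sum /=.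
rewrite rmorph_sum mulmx_sumr mulmx_suml; apply: eq_bigr => k _ /=.
rewrite horner_mxZ -scalemxAr -scalemxAl mul_bidiagX_newton //.
  by rewrite scale_scalar_mx.
by rewrite -ltnS (leq_trans (ltn_ord k)).
Qed.

(** Every factor of a Newton entry is at most 2 / d in modulus, which gives a bound independent of
    the nodes. *)
Lemma ler_mul_newton (C : numClosedFieldType) (m : nat)
    (z : 'I_m.+1 -> C) (d x : C) (u : 'rV[C]_m.+1) :
  0 < d <= 1 -> (forall i, `|z i| <= 1) -> `|x| <= 1 ->
  `|(u *m newton_col z d x) 0 0| <= m.+1%:R * (2 / d) ^+ m.+1 * l2norm u.
Proof.
move=> /andP[d0 d1] z1 x1; rewrite mxE -mulrA.
apply: le_trans (ler_norm_sum _ _ _) _.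
have -> : m.+1%:R = \sum_(i < m.+1) 1 :> C by rewrite sumr_const card_ord.
rewrite mulr_suml.
apply: ler_sum => i _; rewrite mul1r normrM mulrC.
rewrite ler_pM ?normr_ge0 ?ler_entry_l2norm // mxE normr_prod.
(* This allows padding the product over k < i to all m+1 indices. *)
have le1 : 1 <= 2 / d by rewrite ler_pdivlMr // mul1r (le_trans d1) ?ler1n.
have -> : (2 / d) ^+ m.+1 = \prod_(k < m.+1) (2 / d).
  by rewrite prodr_const card_ord.
rewrite [X in _ <= X](bigID (fun k : 'I_m.+1 => (k < i)%N)) /=.
rewrite -[X in X <= _]mulr1 ler_pM ?prodr_ge0 //.
  apply: ler_prod => k _; rewrite normr_ge0 /= normrM normfV (gtr0_norm d0).
  rewrite ler_pM2r ?invr_gt0 // (le_trans (ler_normB _ _)) //.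
  by rewrite [2](natrD _ 1 1) lerD.
by elim/big_rec: _ => // k y _ y1; rewrite mulr_ege1.
Qed.

(** * Exponential sums and the estimate for small zeros *)

(** For each l, the factor b_l - X collapses the geometric sum of b_l^j X^(n-1-j) to b_l^n - X^n;
    the other factors stay. *)
Lemma exp_sum_convolution (R : comNzRingType) (L n : nat)
    (bs Cs : 'I_L -> R) :
  (\prod_l ((bs l)%:P - 'X)) *
    (\sum_(j < n) (\sum_l Cs l * bs l ^+ j) *: 'X^(n.-1 - j)) =
  \sum_l (Cs l * bs l ^+ n) *: \prod_(k | k != l) ((bs k)%:P - 'X) -
  'X^n * \sum_l Cs l *: \prod_(k | k != l) ((bs k)%:P - 'X).
Proof.
under [X in _ * X]eq_bigr do rewrite scaler_suml.
rewrite exchange_big !mulr_sumr -sumrB; apply: eq_bigr => l _.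
rewrite (bigD1 l) //= mulrAC -scalerAr -!mul_polyC polyCM.
set Q := \prod_(k | k != l) _.
suff -> : ((bs l)%:P - 'X) * \sum_(j < n) (Cs l * bs l ^+ j) *: 'X^(n.-1 - j)
    = (Cs l)%:P * ((bs l ^+ n)%:P - 'X^n) by ring.
rewrite -[in RHS]opprB [in RHS]polyC_exp subrXX.
rewrite -mulNr opprB mulrCA; congr (_ * _).
rewrite mulr_sumr; apply: eq_bigr => j _.
by rewrite -mul_polyC polyCM polyC_exp; ring.
Qed.

Lemma size_prod_sub_le (R : idomainType) (I : finType) (P : pred I)
    (x : I -> R) :
  (size (\prod_(i | P i) ((x i)%:P - 'X))%R <= #|P|.+1)%N.
Proof.
rewrite (eq_bigr (fun i => - ('X - (x i)%:P))) => [|i _]; last by rewrite opprB.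
rewrite prodrN -signr_odd mulr_sign -big_filter.
have [e _ _ [_ size_e]] := big_enumP P.
by case: ifP => _; rewrite ?size_polyN size_prod_XsubC size_e.
Qed.

Lemma ler_mul_prod_sub (C : numClosedFieldType) (I : finType) (P : pred I)
    (x : I -> C) (m : nat) (A : 'M[C]_m.+1) (u : 'rV[C]_m.+1) :
  (forall i, `|x i| <= 1) ->
  (forall u : 'rV_m.+1, l2norm (u *m A) <= l2norm u) ->
  l2norm (u *m horner_mx A (\prod_(i | P i) ((x i)%:P - 'X))) <=
  2 ^+ #|I| * l2norm u.
Proof.
move=> x1 A1; apply: (@le_trans _ _ (2 ^+ #|P| * l2norm u)); last first.
  by rewrite ler_wpM2r ?l2norm_ge0 // ler_weXn2l ?ler1n // max_card.
rewrite -prodr_const; elim/big_rec2: _ => [|i y p Pi IHp].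
  by rewrite rmorph1 mulmx1 mul1r.
rewrite mulrC rmorphM mulmxA /= rmorphB /= horner_mx_C horner_mx_X.
set w := u *m _ in IHp *; rewrite mulmxBr mul_mx_scalar.
apply: le_trans (ler_l2normB _ _) _; rewrite l2normZ -mulrA.
apply: (@le_trans _ _ (2 * l2norm w)); last by rewrite ler_wpM2l.
by rewrite mulr_natl mulr2n lerD // ler_piMl ?l2norm_ge0.
Qed.

(** M is chosen before n and the zeros. When q < b the conclusion fails for large n, so such an n
    cannot have m+1 zeros of modulus at most r. *)
Lemma small_zeros_bound (C : numClosedFieldType) (m : nat)
    (alpha : nat -> C) (bs Cs : 'I_m.+1 -> C) (c K b r d q : C) :
  is_verblunsky alpha ->
  0 < c -> (forall k, c <= \prod_(i < k) (1 - `|alpha i|)) ->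
  0 < b < 1 -> injective bs -> (forall l, `|bs l| = b) ->
  (forall l, Cs l != 0) ->
  0 <= r -> 0 < d -> r + d < q -> q <= 1 -> b ^+ 2 <= q ->
  (forall i, `|alpha i| <= K * b ^+ i) ->
  (forall i, `|alpha i - \sum_l Cs l * bs l ^+ i| <= K * q ^+ i) ->
  exists2 M : C, 0 <= M & forall (n : nat) (z : 'I_m.+1 -> C),
    (forall i, `|z i| <= r) ->
    \prod_i ('X - (z i)%:P) %| monic_opuc alpha n -> b ^+ n <= M * q ^+ n.
Proof.
move=> alpha1 c0 cP /andP[b0 b1] bs_inj bsb Cs0 r0 d0 rdq q1 b2q alphab alphaq.
pose be l := (bs l)^*; pose ce l := (Cs l)^*.
pose Q l := \prod_(k | k != l) ((be k)%:P - 'X).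
pose N n := \sum_l (ce l * be l ^+ n) *: Q l.
pose gamma j := \sum_l ce l * be l ^+ j.
(* The unrolled recursion contains conj(alpha_j), hence the conjugated nodes and coefficients. *)
have gammaE j : gamma j - (alpha j)^* =
    - (alpha j - \sum_l Cs l * bs l ^+ j)^*.
  rewrite rmorphB opprB rmorph_sum; congr (_ - _).
  by apply: eq_bigr => l _; rewrite rmorphM rmorphXn.
have gammaq j : `|gamma j - (alpha j)^*| <= K * q ^+ j.
  by rewrite gammaE normrN norm_conjC.
have be1 l : `|be l| <= 1 by rewrite norm_conjC bsb ltW.
have be_inj : injective be by move=> l k /(can_inj (@conjCK C))/bs_inj.
have q0 : 0 <= q by rewrite ltW // (le_lt_trans _ rdq) // addr_ge0 // ltW.
have d1 : d <= 1 by rewrite (le_trans _ q1) // (le_trans _ (ltW rdq)) // lerDr.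
have NE n : (N n).[be ord0] =
    ce ord0 * be ord0 ^+ n * \prod_(k | k != ord0) (be k - be ord0).
  rewrite /N horner_sum (bigD1 ord0) //= big1 ?addr0 => [|l neq_l].
    rewrite hornerZ horner_prod; congr (_ * _); apply: eq_bigr => k _.
    by rewrite !hornerE.
  rewrite hornerZ horner_prod (bigD1 ord0) 1?eq_sym //=.
  by rewrite !hornerE subrr /= mulr0 mul0r.
(* At the node [be ord0] only the term l = 0 of N_n survives, so its modulus there is kappa b^n. *)
pose kappa := `|ce ord0 * \prod_(k | k != ord0) (be k - be ord0)|.
have kappa0 : 0 < kappa.
  rewrite normr_gt0 mulf_neq0 ?conjC_eq0 //; apply/prodf_neq0 => k neq_k.
  by rewrite subr_eq0 (inj_eq be_inj).
(* Each [Q l] omits one of the m+1 factors, so m+1 interpolation nodes determine N_n. *)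
have sN n : (size (N n) <= m.+1)%N.
  apply: leq_trans (size_sum _ _ _) _; apply/bigmax_leqP => l _.
  apply: leq_trans (size_scale_leq _ _) _.
  by rewrite (leq_trans (size_prod_sub_le _ _)) // cardC1 card_ord.
(* K1 bounds the convolution, K2 adds the cost of the product of the b_l - X and of the X^n term,
   and D bounds the Newton column. *)
pose K1 := (K + K * K / (1 - b) / c) / (q - (r + d)) + c^-1.
pose K2 := 2 ^+ m.+1 * K1 + \sum_l `|ce l| * 2 ^+ m.+1.
pose D : C := m.+1%:R * (2 / d) ^+ m.+1.
have K0 : 0 <= K by have := alphab 0%N; rewrite mulr1; apply: le_trans.
have K10 : 0 <= K1.
  rewrite addr_ge0 ?invr_ge0 ?(ltW c0) // divr_ge0 ?subr_ge0 ?(ltW rdq) //.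
  by rewrite addr_ge0 // !divr_ge0 ?mulr_ge0 ?subr_ge0 ?(ltW c0) ?(ltW b1).
have D0 : 0 <= D by rewrite mulr_ge0 // exprn_ge0 // divr_ge0 // ltW.
exists (D * K2 / kappa) => [|n z zr dvd_z].
  rewrite divr_ge0 ?(ltW kappa0) // mulr_ge0 // addr_ge0 ?mulr_ge0 //.
  by rewrite sumr_ge0 // => l _; rewrite mulr_ge0 ?exprn_ge0.
pose A := bidiag_mx z d; pose e : 'rV[C]_m.+1 := delta_mx 0 ord0.
have Ar (u : 'rV_m.+1) : l2norm (u *m A) <= (r + d) * l2norm u.
  by rewrite l2norm_mul_bidiag // ltW.
have A1 (u : 'rV_m.+1) : l2norm (u *m A) <= l2norm u.
  rewrite (le_trans (Ar u)) // ler_piMl ?l2norm_ge0 //.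
  by rewrite (le_trans (ltW rdq)).
have Phi0 : horner_mx A (monic_opuc alpha n) = 0.
  have /dvdpP[p ->] := dvd_z.
  by rewrite -(char_poly_bidiag z d) rmorphM /= Cayley_Hamilton mulr0.
have rd0 : 0 <= r + d by rewrite addr_ge0 // ltW.
have eNA : l2norm (e *m horner_mx A (N n)) <= K2 * q ^+ n.
  have := exp_sum_convolution n be ce.
  move/esym/eqP; rewrite subr_eq -/(N n) => /eqP ->.
  rewrite rmorphD mulmxDr (le_trans (ler_l2normD _ _)) // mulrDl lerD //.
    rewrite mulrC rmorphM mulmxA /= (le_trans (ler_mul_prod_sub _ _ be1 A1)) //.
    rewrite card_ord -mulrA ler_wpM2l ?exprn_ge0 //.
    rewrite -[K1 * _]mulr1 -(l2norm_delta C (@ord0 m)).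
    apply: (ler_unit_mul_convolution (gamma := gamma) (b := b)) => //.
    - by rewrite ltW.
    - by rewrite rd0.
  rewrite mulrC rmorphM mulmxA (le_trans (ler_l2norm_mulX _ _ rd0 Ar)) //.
  rewrite mulrC ler_pM ?l2norm_ge0 ?exprn_ge0 //; last first.
    by rewrite lerXn2r // ?nnegrE // ltW.
  rewrite rmorph_sum mulmx_sumr (le_trans (ler_l2norm_sum _ _ _)) //.
  apply: ler_sum => l _; rewrite /= horner_mxZ -scalemxAr l2normZ ler_wpM2l //.
  apply: le_trans (ler_mul_prod_sub _ _ be1 A1) _.
  by rewrite card_ord l2norm_delta mulr1.
rewrite mulrAC ler_pdivlMr // mulrC.
have -> : kappa * b ^+ n = `|(N n).[be ord0]|.
  by rewrite NE mulrAC normrM normrX norm_conjC bsb.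
have d_neq0 : d != 0 by rewrite gt_eqF.
have := mul_bidiag_poly_newton z (be ord0) d_neq0 (sN n).
move/matrixP/(_ 0 0); rewrite [RHS]mxE eqxx mulr1n => <-.
apply: le_trans (ler_mul_newton _ _ _ _) _ => //; first by rewrite d0.
  move=> i; apply: le_trans (zr i) (le_trans _ q1).
  by rewrite (le_trans _ (ltW rdq)) // lerDl ltW.
by rewrite -[D * K2 * _]mulrA; apply: ler_wpM2l D0 _ _ eNA.
Qed.

(** * Uniform constants and eventual bounds *)

(** Weierstrass product inequality for the factors from J on: with S the partial sum, (1 - S)(1 - t)
    exceeds 1 - S - t by S t >= 0. *)
Lemma weierstrass_product_ge (R : numDomainType) (t : nat -> R) (J k : nat) :
  (forall i, 0 <= t i <= 1) ->
  (\prod_(i < J) (1 - t i)) * (1 - \sum_(J <= i < J + k) t i) <=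
  \prod_(i < J + k) (1 - t i).
Proof.
move=> t01; have t1 i : 0 <= 1 - t i by rewrite subr_ge0; case/andP: (t01 i).
elim: k => [|k IHk]; first by rewrite addn0 big_geq // subr0 mulr1.
rewrite addnS big_nat_recr ?leq_addr //= big_ord_recr /=.
apply: le_trans (ler_wpM2r (t1 _) IHk); rewrite -mulrA.
rewrite ler_wpM2l ?prodr_ge0 //; set S := \sum_(_ <= _ < _) _.
have S0 : 0 <= S by rewrite sumr_ge0 // => i _; case/andP: (t01 i).
rewrite -subr_ge0 [X in 0 <= X](_ : _ = S * t (J + k)%N); last by ring.
by rewrite mulr_ge0 //; case/andP: (t01 (J + k)%N).
Qed.

Lemma prod_verblunsky_ge (C : numClosedFieldType) (alpha : nat -> C)
    (K b : C) (J : nat) :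
  is_verblunsky alpha -> 0 <= b < 1 ->
  (forall i, `|alpha i| <= K * b ^+ i) -> K * b ^+ J <= (1 - b) / 2 ->
  exists2 c, 0 < c & forall k, c <= \prod_(i < k) (1 - `|alpha i|).
Proof.
move=> alpha1 b01 alphab KJ; have [b0 b1] := andP b01.
have K0 : 0 <= K by have := alphab 0%N; rewrite mulr1; apply: le_trans.
have a0 i : 0 < 1 - `|alpha i| by rewrite subr_gt0.
pose P k := \prod_(i < k) (1 - `|alpha i|).
have P0 k : 0 < P k by rewrite prodr_gt0.
(* By the choice of J the tail sum is at most K b^J / (1 - b) <= 1/2; for k < J the partial products
   decrease to [P J]. *)
exists (P J / 2) => [|k]; first by rewrite divr_gt0.
have [le_Jk|le_kJ] := leqP J k.
  have a01 i : 0 <= `|alpha i| <= 1 by rewrite normr_ge0 ltW.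
  have := weierstrass_product_ge J (k - J) a01; rewrite subnKC //.
  apply: le_trans; rewrite ler_wpM2l ?(ltW (P0 J)) // lerBrDr -lerBrDl.
  have -> : 1 - 2^-1 = 2^-1 :> C by field.
  apply: (@le_trans _ _ (\sum_(J <= i < k) K * b ^+ i)).
    by apply: ler_sum => i _.
  rewrite -mulr_sumr.
  apply: le_trans (ler_wpM2l K0 (ler_geometric_tail b01 le_Jk)) _.
  by rewrite mulrA ler_pdivrMr ?subr_gt0 // [2^-1 * _]mulrC.
have -> : \prod_(i < k) (1 - `|alpha i|) = P k by [].
apply: (@le_trans _ _ (P J)).
  by rewrite ler_pdivrMr // ler_peMr ?ler1n // ltW.
elim: J {KJ} le_kJ => // J IHJ; rewrite ltnS leq_eqVlt => /predU1P[->|/IHJ].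
  by rewrite /P big_ord_recr /= ler_piMr ?(ltW (P0 _)) // lerBlDr lerDl.
apply: le_trans.
by rewrite /P big_ord_recr /= ler_piMr ?(ltW (P0 _)) // lerBlDr lerDl.
Qed.

Lemma exp_lt_eventually (R : realType) (x : R) (K e : R[i]) :
  0 <= x < 1 -> 0 <= K -> 0 < e ->
  exists N : nat, forall n, (N <= n)%N -> K * x%:C%C ^+ n < e.
Proof.
move=> /andP[x0 x1] K0 e0.
have KR : (complex.Re K)%:C%C = K by rewrite RRe_real // ger0_real.
have eR : (complex.Re e)%:C%C = e by rewrite RRe_real // gtr0_real.
move: K0 e0; rewrite -{}KR -{}eR.
move: (complex.Re K) (complex.Re e) => k r; rewrite lecR ltcR => k0 r0.
(* Dividing by k + 1 instead of k covers k = 0. *)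
have k1 : 0 < k + 1 by rewrite ltr_wpDl.
have x1' : `|x| < 1 by rewrite ger0_norm.
have [N _ xN] := cvgr0_norm_lt _ (cvg_expr x1') _ (divr_gt0 r0 k1).
exists N => n /xN /=; rewrite normrX (ger0_norm x0) ltr_pdivlMr // mulrC.
rewrite -rmorphXn -rmorphM /= ltcR; apply: le_lt_trans.
by rewrite ler_wpM2r ?exprn_ge0 // lerDl.
Qed.

(** The finitely many ratios |f i| / g i with i < N are added to the constant. *)
Lemma bound_all_of_eventually (R : numFieldType) (f g : nat -> R) (k : R)
    (N : nat) :
  0 <= k -> (forall n, 0 < g n) ->
  (forall n, (N <= n)%N -> `|f n| <= k * g n) ->
  exists2 K, 0 <= K & forall n, `|f n| <= K * g n.
Proof.
move=> k0 g0 fN; have t0 i : 0 <= `|f i| / g i by rewrite divr_ge0 // ltW.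
exists (k + \sum_(i < N) `|f i| / g i) => [|n].
  by rewrite addr_ge0 // sumr_ge0.
rewrite mulrDl; have [/fN le_fn|lt_nN] := leqP N n.
  by rewrite ler_wpDr // mulr_ge0 ?sumr_ge0 // ltW.
rewrite ler_wpDl ?mulr_ge0 ?(ltW (g0 n)) // (bigD1 (Ordinal lt_nN)) //=.
rewrite mulrDl divfK ?gt_eqF // lerDl mulr_ge0 ?sumr_ge0 //.
exact: ltW.
Qed.

(** * Zeros as divisors, and the choice of the rates *)

(** The z i are the first m+1 listed zeros that satisfy a; a repeated zero is repeated in the list,
    so divisibility keeps multiplicities. *)
Lemma dvdp_prod_zeros (C : numClosedFieldType) (p : {poly C}) (a : pred C)
    (m : nat) :
  (m < count a (zeros p))%N ->
  exists2 z : 'I_m.+1 -> C, (forall i, a (z i)) &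
    \prod_i ('X - (z i)%:P) %| p.
Proof.
rewrite -size_filter => lt_m; pose s := [seq z <- zeros p | a z].
exists (fun i => nth 0 s i) => [i|].
  have : nth 0 s i \in s by rewrite mem_nth // (leq_trans (ltn_ord i)).
  by rewrite mem_filter => /andP[].
have Dp : p = lead_coef p *: \prod_(z <- zeros p) ('X - z%:P).
  by rewrite /zeros; case: closed_field_poly_normal.
rewrite Dp -mul_polyC dvdp_mull //.
rewrite (bigID a) /= dvdp_mulr //.
have -> : \prod_(z <- zeros p | a z) ('X - z%:P) = \prod_(z <- s) ('X - z%:P).
  by rewrite big_filter.
have -> : \prod_(i < m.+1) ('X - (nth 0 s i)%:P) =
    \prod_(z <- take m.+1 s) ('X - z%:P).
  rewrite [RHS](big_nth 0) size_takel // big_mkord.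
  by apply: eq_bigr => i _; rewrite nth_take.
rewrite -[X in _ %| \prod_(z <- X) _](cat_take_drop m.+1 s) big_cat.
by rewrite dvdp_mulr.
Qed.

Lemma dvdp_orthonormal_opuc (C : numClosedFieldType) (alpha : nat -> C)
    (n : nat) (p : {poly C}) :
  is_verblunsky alpha ->
  (p %| orthonormal_opuc alpha n) = (p %| monic_opuc alpha n).
Proof.
move=> alpha1; rewrite dvdpZr // invr_eq0; apply/prodf_neq0 => j _.
by rewrite sqrtC_eq0 gt_eqF // subr_gt0 exprn_ilt1.
Qed.

Theorem theorem4p1 (R : realType) (L : nat) (b Delta : R)
    (bs Cs : 'I_L -> R[i]) (alpha : nat -> R[i]) :
  (1 <= L)%N ->
  0 < b < 1 ->
  0 < Delta < 1 ->
  injective bs ->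
  (forall l, `|bs l| = b%:C%C) ->
  (forall l, Cs l != 0) ->
  is_verblunsky alpha ->
  (fun n => alpha n - \sum_(l < L) Cs l * bs l ^+ n : R[i]^o)
    =O_\oo (fun n => ((b * Delta) ^+ n)%:C%C : R[i]^o) ->
  forall eps : R, 0 < eps ->
  exists N : nat, forall n : nat, (N <= n)%N ->
    (count (fun z : R[i] => `|z| < (b - eps)%:C%C)%R
       (zeros (orthonormal_opuc alpha n)) <= L - 1)%N.
Proof.
case: L bs Cs => // m bs Cs _ /andP[b0 b1] /andP[D0 D1] bs_inj bsb Cs0 alpha1.
move=> /eqO_exP[k k0 [N0 _ alphaO]] eps eps0.
have bD0 : 0 < b * Delta by rewrite mulr_gt0.
have [K1 K10 alphaK1] : exists2 K, 0 <= K & forall n,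
    `|alpha n - \sum_l Cs l * bs l ^+ n| <= K * ((b * Delta) ^+ n)%:C%C.
  apply: (@bound_all_of_eventually _ _ _ k N0) (ltW k0) _ _ => n.
    by rewrite ltcR exprn_gt0.
  move/alphaO => /= h; apply: le_trans h _; rewrite ler_wpM2l ?(ltW k0) //.
  by rewrite ger0_norm // lecR exprn_ge0 // ltW.
(* One constant serves both the bound on alpha_n and the bound on the error. *)
pose K := K1 + \sum_l `|Cs l|.
have K1K : K1 <= K by rewrite lerDl sumr_ge0.
have bDb : b * Delta <= b by rewrite ler_piMr // ltW.
have alphab n : `|alpha n| <= K * b%:C%C ^+ n.
  rewrite -[alpha n](subrK (\sum_l Cs l * bs l ^+ n)) mulrDl.
  apply: le_trans (ler_normD _ _) _; rewrite lerD //.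
    apply: le_trans (alphaK1 n) _; rewrite ler_wpM2l // -rmorphXn lecR.
    by rewrite lerXn2r // nnegrE ltW.
  apply: le_trans (ler_norm_sum _ _ _) _; rewrite mulr_suml.
  by apply: ler_sum => l _; rewrite normrM normrX bsb.
(* The maximum keeps r nonnegative when eps > b; with a third of the gap, r + d < r + 2d < b. *)
pose r := Num.max (b - eps) 0; pose d := (b - r) / 3.
have r0 : 0 <= r by rewrite le_max lexx orbT.
have rb : r < b by rewrite gt_max b0 ltrBlDr ltrDl eps0.
have d0 : 0 < d by rewrite divr_gt0 // subr_gt0.
(* The three rates are the error of the asymptotics, the quadratic term of the recursion, and a
   strict bound for the norm r + d of the matrix. *)
pose q := Num.max (Num.max (b * Delta) (b ^+ 2)) (r + 2 * d).
have bDq : b * Delta <= q by rewrite !le_max lexx.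
have b2q : b ^+ 2 <= q by rewrite !le_max lexx orbT.
have rdq : r + d < q.
  by rewrite lt_max; apply/orP; right; rewrite ltrD2l ltr_pMl // ltr1n.
have qb : q < b.
  rewrite !gt_max expr2 gtr_pMr // gtr_pMr // D1 b1 /=.
  by rewrite /d; lra.
have q0 : 0 < q by rewrite (lt_le_trans bD0).
have alphaq n : `|alpha n - \sum_l Cs l * bs l ^+ n| <= K * q%:C%C ^+ n.
  apply: le_trans (alphaK1 n) _; rewrite -rmorphXn ler_pM // lecR.
    by rewrite exprn_ge0 // ltW.
  by rewrite lerXn2r // nnegrE ltW.
have bC01 : 0 <= (b%:C%C : R[i]) < 1 by rewrite lecR ltcR ltW.
have [J KJ] : exists J, K * b%:C%C ^+ J <= (1 - b%:C%C) / 2.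
  have [|||J HJ] := @exp_lt_eventually R b K ((1 - b%:C%C) / 2).
  - by rewrite ltW.
  - exact: le_trans K1K.
  - by rewrite divr_gt0 // subr_gt0 ltcR.
  by exists J; rewrite ltW // HJ.
have [c c0 cP] := prod_verblunsky_ge alpha1 bC01 alphab KJ.
have [||||||M M0 HM] := @small_zeros_bound _ m alpha bs Cs c K b%:C%C r%:C%C
  d%:C%C q%:C%C alpha1 c0 cP _ bs_inj bsb Cs0 _ _ _ _ _ alphab alphaq.
- by rewrite !ltcR b0.
- by rewrite lecR.
- by rewrite ltcR.
- by rewrite -rmorphD ltcR.
- by rewrite lecR ltW // (lt_trans qb).
- by rewrite -rmorphXn lecR.
have qb01 : 0 <= q / b < 1.
  by rewrite divr_ge0 ?ltW //= ltr_pdivrMr // mul1r.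
(* From this N on, M (q / b)^n < 1, which contradicts b^n <= M q^n. *)
have [N HN] := exp_lt_eventually qb01 M0 ltr01.
exists N => n /HN Mn; rewrite subn1 /= leqNgt; apply/negP.
move=> /dvdp_prod_zeros[z zr]; rewrite dvdp_orthonormal_opuc // => dvd_z.
have /HM/(_ dvd_z) : forall i, `|z i| <= r%:C%C.
  by move=> i; rewrite ltW // (lt_le_trans (zr i)) // lecR le_max lexx.
have bn0 : 0 < (b%:C%C : R[i]) ^+ n by rewrite exprn_gt0 // ltcR.
rewrite lt_geF // -[X in _ < X]mul1r -ltr_pdivrMr // -mulrA.
move: Mn; rewrite -expr_div_n -fmorph_div; exact.
Qed.
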